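(* Let $G(x,z)=\sum_{n\ge0}P_n(x)z^n$ and $H(x,z)=\sum_{n\ge0}R_n(x)z^n$. Then $$G(x,z)=\frac{2+(x-1)\left(1-\sqrt{\frac{1+2xz}{1-2xz}}\right)}{2\left(1-z(1+x^2)\right)},\qquad H(x,z)=\frac{2x+(1-x)\left(1-\sqrt{\frac{1+2z}{1-2z}}\right)}{2\left(x-z(1+x^2)\right)}.$$ The series $G(x,z)$ converges (to the stated expression) when $|z(1+x^2)|<1$ and $|xz|<1/2$, and $H(x,z)$ converges (to the stated expression) when $|z(1+x^2)|<|x|$ and $|2z|<1$.
   Context: For $0\le k\le n$ let $\mathcal{B}(n,k)=\binom{n}{\lfloor (n-k)/2\rfloor}$, $P_n(x)=\sum_{k=0}^n\mathcal{B}(n,k)x^{n-k}$ and $R_n(x)=\sum_{k=0}^n\mathcal{B}(n,k)x^{k}$. The square roots denote the branch with value $1$ at $z=0$ (the principal branch). *)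

(* Defs.v *)
From HB Require Import structures.
From mathcomp Require Import all_boot all_order all_algebra.
From mathcomp Require Import complex.
From mathcomp Require Import all_classical all_reals all_analysis.

Set Implicit Arguments.
Unset Strict Implicit.
Unset Printing Implicit Defensive.

Import Order.TTheory GRing.Theory Num.Theory.
Import numFieldNormedType.Exports.

Local Open Scope ring_scope.

Definition calB (n k : nat) : nat := 'C(n, (n - k)./2).

Definition Ppoly (K : nzRingType) (n : nat) : {poly K} :=
  \sum_(k < n.+1) (calB n k)%:R *: 'X^(n - k).

Definition Rpoly (K : nzRingType) (n : nat) : {poly K} :=
  \sum_(k < n.+1) (calB n k)%:R *: 'X^k.

(* Power series in z, as sequences of partial sums: series u n is the sum of
   the first n terms. The values are typed R[i]^o so that they carry the topology given by their norm. *)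
Definition serG (R : realType) (x z : R[i]) : nat -> R[i]^o :=
  series (fun n => (Ppoly R[i] n).[x] * z ^+ n).

Definition serH (R : realType) (x z : R[i]) : nat -> R[i]^o :=
  series (fun n => (Rpoly R[i] n).[x] * z ^+ n).

(* sqrtc is the principal square root (nonnegative real part), unlike the
   sqrtC of numClosedFieldType, whose values have nonnegative imaginary part. *)
Definition closedG (R : realType) (x z : R[i]) : R[i] :=
  (2 + (x - 1) * (1 - sqrtc ((1 + 2 * x * z) / (1 - 2 * x * z))))
    / (2 * (1 - z * (1 + x ^+ 2))).

Definition closedH (R : realType) (x z : R[i]) : R[i] :=
  (2 * x + (1 - x) * (1 - sqrtc ((1 + 2 * z) / (1 - 2 * z))))
    / (2 * (x - z * (1 + x ^+ 2))).

(* Main.v *)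
Require Import Defs.
From HB Require Import structures.
From mathcomp Require Import all_boot all_order all_algebra.
From mathcomp Require Import complex.
From mathcomp Require Import all_classical all_reals all_analysis.
From mathcomp Require Import ring lra zify.
Import Order.TTheory GRing.Theory Num.Theory.
Import numFieldNormedType.Exports.
Local Open Scope classical_set_scope.
Local Open Scope ring_scope.

(* Pascal's rule gives
   P_{n+1} = (1 + x^2) P_n + (1 - x) 'C(n, n./2) x^(n+1), so the partial sums
   of G satisfy y_{n+1} = z (1 + x^2) y_n + b_n, where b_n is affine in the
   partial sums f_n(u) of the Taylor series of sqrt ((1 + u) / (1 - u)) at
   u = 2 x z. Such a recurrence contracts when |z (1 + x^2)| < 1, so everything
   rests on the limit of f_n. The self-convolution of the Taylor coefficients is
   1, 2, 2, 2, ..., hence (1 - u) f_n^2 tends to 1 + u; the coefficients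
   decrease, hence |(1 - u) f_n - 1| <= 1 and Re ((1 - u) f_n) >= 0. This selects
   the principal root. H follows from R_n(x) = x^n P_n(1/x). *)

(** * Values of [Ppoly] and their recurrence in [n] *)

Lemma horner_Ppoly (K : comNzRingType) (n : nat) (x : K) :
  (Ppoly K n).[x] = \sum_(j < n.+1) ('C(n, j./2))%:R * x ^+ j.
Proof.
rewrite /Ppoly horner_sum (reindex_inj rev_ord_inj) /=; apply: eq_bigr => j _.
rewrite hornerZ hornerXn /calB !subSS subKn //; exact: (ltn_ord j).
Qed.

Lemma bin_uphalf n : 'C(n, n.+1./2) = 'C(n, n./2).
Proof.
rewrite -[RHS]bin_sub; last lia.
congr binomial; lia.
Qed.

(** Pascal's rule splits the terms of degree at least 2 into two shifted copies of [P_n]. One copy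
    lacks its top term and the other has an extra one; [bin_uphalf] gives both the coefficient
    ['C(n, n./2)], whence the factor [1 - x]. *)
Lemma horner_Ppoly_rec (K : comNzRingType) (n : nat) (x : K) :
  (Ppoly K n.+1).[x] = (1 + x ^+ 2) * (Ppoly K n).[x]
     + (1 - x) * ('C(n, n./2))%:R * x ^+ n.+1.
Proof.
rewrite !horner_Ppoly big_ord_recl big_ord_recl /=.
under eq_bigr => i _.
  rewrite /bump /= !add1n /= binS natrD mulrDl.
over.
rewrite big_split /=.
have -> : \sum_(i < n) ('C(n, i./2))%:R * x ^+ i.+2
   = x ^+ 2 * (\sum_(j < n.+1) ('C(n, j./2))%:R * x ^+ j - ('C(n, n./2))%:R * x ^+ n).
  rewrite big_ord_recr /= addrK mulr_sumr; apply: eq_bigr => i _.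
  by rewrite !exprS; ring.
have -> : \sum_(i < n) ('C(n, i./2.+1))%:R * x ^+ i.+2
   = \sum_(j < n.+1) ('C(n, j./2))%:R * x ^+ j + ('C(n, n./2))%:R * x ^+ n.+1 - 1 - x.
  rewrite -[in RHS]bin_uphalf.
  have E := @big_ord_recr K 0 +%R n.+1 (fun j : 'I_n.+2 => ('C(n, j./2))%:R * x ^+ j).
  rewrite /= in E; rewrite -E big_ord_recl big_ord_recl /= !bin0 !mul1r expr0 expr1.
  under [X in _ = _ + (_ + X) - _ - _]eq_bigr => i _ do rewrite /bump /= !add1n /=.
  by ring.
by rewrite /bump /= !bin0 !exprS expr0; ring.
Qed.

(** * Taylor coefficients of the square root and their self-convolution *)

Section CentralCoefficients.
Variable K : numFieldType.

(* The Taylor coefficients of sqrt ((1 + u) / (1 - u)). *)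
Fixpoint sqrt_coef (n : nat) : K :=
  if n is m.+1 then sqrt_coef m * (if odd m then m%:R / m.+1%:R else 1) else 1.

Lemma sqrt_coef_ge0 n : 0 <= sqrt_coef n.
Proof.
elim: n => [|n IH] /=; first exact: ler01.
by apply: mulr_ge0 => //; case: ifP => _; rewrite ?ler01 // divr_ge0 ?ler0n.
Qed.

Lemma sqrt_coefS_le n : sqrt_coef n.+1 <= sqrt_coef n.
Proof.
rewrite /= ler_piMr ?sqrt_coef_ge0 //; case: ifP => _ //.
by rewrite ler_pdivrMr ?ltr0n // mul1r ler_nat.
Qed.

(** Coefficient form of the differential equation [(1 - u^2) f' = f] satisfied by
    [f = sqrt ((1 + u) / (1 - u))]. *)
Lemma sqrt_coef_rec n :
  n.+2%:R * sqrt_coef n.+2 = sqrt_coef n.+1 + n%:R * sqrt_coef n.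
Proof.
have n1 : (1 + n%:R : K) != 0 by rewrite nat1r pnatr_eq0.
have n2 : (2 + n%:R : K) != 0 by rewrite -natrD pnatr_eq0.
by rewrite /=; case: (odd n) => /=; field; rewrite ?n1 ?n2.
Qed.

(** Links the Taylor coefficients to the binomials in [horner_Ppoly_rec]. For odd [n] the two Pascal
    summands are equal; for even [n] the absorption identity [mul_bin_diag] gives the ratio. *)
Lemma sqrt_coefSE n : sqrt_coef n.+1 = ('C(n, n./2))%:R / 2 ^+ n.
Proof.
elim: n => [|n IH]; first by rewrite /= mulr1 bin0 expr0 divr1.
have n2 : (2 + n%:R : K) != 0 by rewrite -natrD pnatr_eq0.
have t2 : (2 ^+ n : K) != 0 by rewrite expf_neq0 ?pnatr_eq0.
rewrite -[LHS]/(sqrt_coef n.+1 * (if odd n.+1 then n.+1%:R / n.+2%:R else 1)) IH exprS.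
have [on|on] := boolP (odd n).
  rewrite /= on /=; have -> : ('C(n.+1, uphalf n) = 2 * 'C(n, n./2))%N.
    have e : 'C(n, n./2.+1) = 'C(n, n./2) by rewrite -bin_uphalf /= uphalf_half on.
    by rewrite uphalf_half on add1n binS e mul2n addnn.
  by rewrite natrM; field.
have /(congr1 (fun k => k%:R : K)) : ('C(n.+1, uphalf n) * n.+2 = 2 * n.+1 * 'C(n, n./2))%N.
  rewrite -(bin_uphalf n.+1) -mulnA mul_bin_diag.
  by rewrite mulnA mulnC; congr (_ * _)%N; lia.
rewrite /= (negbTE on) /= !natrM => E; apply: (mulIf n2).
rewrite [RHS]mulrAC [in RHS](_ : 2 + n%:R = n.+2%:R :> K); last by rewrite -natrD.
rewrite E; field.
by rewrite n2 t2.
Qed.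

Lemma sqrt_coef0 : sqrt_coef 0 = 1. Proof. by []. Qed.

Lemma sqrt_coef1 : sqrt_coef 1 = 1. Proof. by rewrite /= mulr1. Qed.

#[global] Arguments sqrt_coef : simpl never.

Definition sqrt_conv n := \sum_(i < n.+1) sqrt_coef i * sqrt_coef (n - i).

Lemma sqrt_conv_weighted n :
  2 * \sum_(i < n.+1) i%:R * (sqrt_coef i * sqrt_coef (n - i)) = n%:R * sqrt_conv n.
Proof.
rewrite mulr_natl mulr2n {2}(reindex_inj rev_ord_inj) /= -big_split /= mulr_sumr.
apply: eq_bigr => i _; rewrite subSS subKn; last exact: (ltn_ord i).
rewrite natrB; last exact: (ltn_ord i).
by ring.
Qed.

(** Coefficient form of [(1 - u^2) (f^2)' = 2 f^2]. The weights [i] stand for differentiating one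
    factor, and symmetry under [i -> n - i] doubles them. *)
Lemma sqrt_conv_rec n :
  n.+2%:R * sqrt_conv n.+2 = 2 * sqrt_conv n.+1 + n%:R * sqrt_conv n.
Proof.
rewrite -!sqrt_conv_weighted -mulrDr; congr (2 * _).
rewrite /sqrt_conv big_ord_recl big_ord_recl [in RHS]big_ord_recl /=.
rewrite sqrt_coef1 [bump 0 0]/= !subSS !subn0 mul0r add0r !mul1r -addrA; congr (_ + _).
rewrite -big_split /=; apply: eq_bigr => i _.
have -> : bump 0 (bump 0 i) = i.+2 by [].
have -> : bump 0 i = i.+1 by [].
by rewrite !subSS mulrA sqrt_coef_rec; ring.
Qed.

Lemma sqrt_convE n : sqrt_conv n.+1 = 2.
Proof.
suff: sqrt_conv n.+1 = 2 /\ sqrt_conv n.+2 = 2 by case.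
have c1 : sqrt_conv 1 = 2.
  by rewrite /sqrt_conv big_ord_recl big_ord1 subn0 subnn sqrt_coef1 sqrt_coef0 mulr1.
elim: n => [|n [IH1 IH2]]; split => //.
  (* At index 0 the factor [n%:R] removes [sqrt_conv 0], the one value that is 1 and not 2. *)
  have h := sqrt_conv_rec 0; rewrite mul0r addr0 c1 in h.
  by apply: (@mulfI _ 2) => //; rewrite pnatr_eq0.
have h := sqrt_conv_rec n.+1.
apply: (@mulfI _ n.+3%:R); first by rewrite pnatr_eq0.
by rewrite h IH1 IH2; ring.
Qed.
End CentralCoefficients.

(** * Estimates for the partial sums and their squares *)

Section SquareEstimate.
Variable K : numFieldType.
Implicit Type u : K.

Definition sqrt_psum (u : K) (N : nat) : K := \sum_(n < N) sqrt_coef K n * u ^+ n.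

(** Summation by parts: up to the last term, the difference is a sum of decrements of [sqrt_coef]
    times powers of [u], and the decrements telescope to [1 - sqrt_coef K N]. The last term costs
    the remaining [sqrt_coef K N]. *)
Lemma sqrt_psum_near1 u N : `|u| <= 1 -> `|(1 - u) * sqrt_psum u N - 1| <= 1.
Proof.
move=> u1; case: N => [|N].
  by rewrite /sqrt_psum big_ord0 mulr0 sub0r normrN normr1.
have d0 := sqrt_coef_ge0 K.
have h : `|(1 - u) * sqrt_psum u N.+1 - 1 + sqrt_coef K N * u ^+ N.+1|
    <= 1 - sqrt_coef K N.
  elim: N => [|N IH].
    rewrite /sqrt_psum big_ord1 sqrt_coef0 expr0 expr1.
    by rewrite (_ : _ + _ = 0) ?normr0 ?subrr //; ring.
  rewrite /sqrt_psum big_ord_recr /= -/(sqrt_psum u N.+1).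
  set S := sqrt_psum u N.+1 in IH *.
  have -> : (1 - u) * (S + sqrt_coef K N.+1 * u ^+ N.+1) - 1
     + sqrt_coef K N.+1 * u ^+ N.+2 =
     (1 - u) * S - 1 + sqrt_coef K N * u ^+ N.+1
     - (sqrt_coef K N - sqrt_coef K N.+1) * u ^+ N.+1 by rewrite !exprS; ring.
  apply: le_trans (ler_normB _ _) _.
  have -> : 1 - sqrt_coef K N.+1 =
     (1 - sqrt_coef K N) + (sqrt_coef K N - sqrt_coef K N.+1) by ring.
  apply: lerD => //; rewrite normrM normrX ger0_norm ?subr_ge0 ?sqrt_coefS_le //.
  by rewrite ler_piMr ?subr_ge0 ?sqrt_coefS_le // exprn_ile1.
have -> : (1 - u) * sqrt_psum u N.+1 - 1 =
   ((1 - u) * sqrt_psum u N.+1 - 1 + sqrt_coef K N * u ^+ N.+1)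
   - sqrt_coef K N * u ^+ N.+1 by ring.
apply: le_trans (ler_normB _ _) _.
rewrite -[leRHS](subrK (sqrt_coef K N)) lerD // normrM normrX ger0_norm //.
by rewrite ler_piMr // exprn_ile1.
Qed.

(** Below degree [N] truncation does not affect the square. From degree [N] on it only drops
    nonnegative products, so each coefficient stays below the full convolution, which is at most
    2. *)
Lemma sqrt_psum_sqr_coef N : exists e : nat -> K,
  (forall u, sqrt_psum u N ^+ 2 =
     \sum_(k < N) sqrt_conv K k * u ^+ k + u ^+ N * \sum_(k < N) e k * u ^+ k) /\
  (forall k, `|e k| <= 2).
Proof.
pose p := \poly_(i < N) sqrt_coef K i.
have d0 := sqrt_coef_ge0 K.
have pE u : sqrt_psum u N = p.[u] by rewrite horner_poly.
have sp : (size (p * p)%R <= N + N)%N.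
  apply: leq_trans (size_polyMleq _ _) _; apply: leq_trans (leq_pred _) _.
  by rewrite leq_add // size_poly.
have T2 k : sqrt_conv K k <= 2.
  case: k => [|k]; last by rewrite sqrt_convE.
  by rewrite /sqrt_conv big_ord1 /= sqrt_coef0 mulr1 ler1n.
have p0 i : 0 <= p`_i <= sqrt_coef K i.
  by rewrite coef_poly; case: ifP => _; rewrite d0 lexx.
exists (fun k => (p * p)`_(N + k)); split=> [u|k].
  rewrite pE expr2 -hornerM (horner_coef_wide u sp) big_split_ord /= mulr_sumr.
  congr (_ + _); apply: eq_bigr => i _; last by rewrite exprD; ring.
  rewrite coefM; congr (_ * _); apply: eq_bigr => j _; rewrite !coef_poly.
  by rewrite !ifT //; have := ltn_ord i; have := ltn_ord j; lia.
rewrite coefM ger0_norm; last first.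
  by apply: sumr_ge0 => j _; rewrite mulr_ge0 //; [case/andP: (p0 j)|case/andP: (p0 (N + k - j)%N)].
apply: le_trans (T2 (N + k)%N); apply: ler_sum => j _.
by case/andP: (p0 j) => ? ?; case/andP: (p0 (N + k - j)%N) => ? ?; apply: ler_pM.
Qed.

Lemma sqrt_psum_sqr u N : `|u| < 1 ->
  (1 - `|u|) * `|(1 - u) * sqrt_psum u N.+1 ^+ 2 - (1 + u)| <= 6 * `|u| ^+ N.+1.
Proof.
move=> u1; have [e [-> e2]] := sqrt_psum_sqr_coef N.+1.
have geo v M : (1 - v) * \sum_(k < M) v ^+ k = 1 - v ^+ M :> K.
  by rewrite -[1 - v]opprB mulNr -subrX1 opprB.
have -> : \sum_(k < N.+1) sqrt_conv K k * u ^+ k = 2 * \sum_(k < N.+1) u ^+ k - 1.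
  rewrite !big_ord_recl /= /sqrt_conv big_ord1 /= sqrt_coef0 expr0.
  under eq_bigr => i _ do rewrite -/(sqrt_conv K i.+1) sqrt_convE.
  by rewrite -mulr_sumr; ring.
set E := \sum_(k < N.+1) e k * _.
have -> : (1 - u) * (2 * \sum_(k < N.+1) u ^+ k - 1 + u ^+ N.+1 * E) - (1 + u)
   = u ^+ N.+1 * ((1 - u) * E - 2).
  rewrite mulrDr mulrBr mulrCA geo; ring.
rewrite normrM mulrCA normrX mulrC ler_wpM2r ?exprn_ge0 //.
have r0 : 0 <= 1 - `|u| by rewrite subr_ge0 ltW.
have hE : (1 - `|u|) * `|E| <= 2.
  apply: le_trans (_ : (1 - `|u|) * (2 * \sum_(k < N.+1) `|u| ^+ k) <= _).
    rewrite ler_wpM2l // mulr_sumr; apply: le_trans (ler_norm_sum _ _ _) _.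
    by apply: ler_sum => k _; rewrite normrM normrX ler_wpM2r ?exprn_ge0.
  by rewrite mulrCA geo ler_piMr ?ler0n // gerBl exprn_ge0.
apply: le_trans (_ : (1 - `|u|) * (`|1 - u| * `|E| + 2) <= _).
  rewrite ler_wpM2l //; apply: le_trans (ler_normB _ _) _.
  by rewrite normrM (ger0_norm (ler0n _ 2)).
(* The 6 collects [2 * 2] from [|1 - u| <= 2] and [hE], and 2 from the geometric remainder. *)
rewrite mulrDr mulrCA (_ : 6 = 2 * 2 + 2); last by ring.
apply: lerD.
  apply: ler_pM => //; first exact: mulr_ge0.
  apply: le_trans (ler_normB _ _) _; rewrite normr1 (_ : 2 = 1 + 1); last by ring.
  by rewrite lerD // ltW.
by rewrite ler_piMl ?ler0n // gerBl.
Qed.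
End SquareEstimate.

Arguments sqrt_psum {K}.

(** * Limits of geometric sequences and contracting recurrences over [R[i]] *)

Section ComplexAnalysis.
Variable R : realType.
Implicit Types (q M eps : R[i]).

(** In the order of [R[i]] the sign hypotheses force all three numbers to be real, so the real
    geometric limit applies. *)
Lemma geometric_lt_near q M eps : 0 <= q -> q < 1 -> 0 <= M -> 0 < eps ->
  \forall n \near \oo, M * q ^+ n < eps.
Proof.
move=> q0 q1 M0 eps0.
have realE (c : R[i]) : 0 <= c -> exists a : R, c = a%:C%C.
  by move=> c0; exists (complex.Re c); rewrite RRe_real // ger0_real.
have [a qE] := realE _ q0; have [m ME] := realE _ M0.
have [e eE] := realE _ (ltW eps0); subst q M eps.
rewrite !ltcR !lecR in q0 q1 eps0.
have a1 : `|a| < 1 by rewrite ger0_norm.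
have /cvgrPdist_lt/(_ _ eps0) := cvg_geometric m a1; apply: filterS => n.
rewrite sub0r normrN /geometric /= => h.
rewrite -rmorphXn -rmorphM /= ltcR; exact: le_lt_trans (ler_norm _) h.
Qed.

Lemma cvg_linear_rec (D l : R[i]) (y b : nat -> R[i]) : `|D| < 1 ->
  (forall n, y n.+1 = D * y n + b n) ->
  b @ \oo --> (l : R[i]^o) -> y @ \oo --> (l / (1 - D) : R[i]^o).
Proof.
move=> D1 yS bl; have D0 : 0 < 1 - `|D| by rewrite subr_gt0.
have nD : 1 - D != 0.
  by apply: contraTneq D1 => /eqP; rewrite subr_eq0 => /eqP <-; rewrite normr1 ltxx.
apply/(@cvgrPdist_lt _ R[i]^o) => eps eps0.
have e20 : 0 < eps / 2 by rewrite divr_gt0.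
(* With this tolerance the errors of [b], summed against powers of [|D|], contribute at most
   [eps / 2]. *)
have /(@cvgrPdist_lt _ R[i]^o)/(_ _ (mulr_gt0 e20 D0)) [N _ bN] := bl.
have [M _ DM] := geometric_lt_near _ _ _ (normr_ge0 D) D1 (normr_ge0 (l / (1 - D) - y N)) e20.
exists (N + M)%N => //= n Nn.
have bound k : `|l / (1 - D) - y (N + k)%N| <= `|l / (1 - D) - y N| * `|D| ^+ k + eps / 2.
  elim: k => [|k IH]; first by rewrite addn0 expr0 mulr1 lerDl ltW.
  rewrite addnS yS.
  have -> : l / (1 - D) - (D * y (N + k)%N + b (N + k)%N) =
     D * (l / (1 - D) - y (N + k)%N) + (l - b (N + k)%N) by field.
  apply: le_trans (ler_normD _ _) _; rewrite normrM.
  have -> : `|l / (1 - D) - y N| * `|D| ^+ k.+1 + eps / 2 =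
    `|D| * (`|l / (1 - D) - y N| * `|D| ^+ k + eps / 2) + eps / 2 * (1 - `|D|).
    by rewrite exprS; ring.
  apply: lerD; first exact: ler_wpM2l.
  by apply/ltW/bN; rewrite /= leq_addr.
rewrite -(subnKC (leq_trans (leq_addr M N) Nn)).
apply: le_lt_trans (bound _) _; rewrite [ltRHS](splitr eps) ltrD2r.
by apply: DM; rewrite /= leq_subRL // (leq_trans (leq_addr M N) Nn).
Qed.

(** * Half-planes, sectors and the choice of the principal root *)

Lemma Re_sqrtc_ge0 (c : R[i]) : 0 <= complex.Re (sqrtc c).
Proof. by case: c => a b /=; rewrite sqrtr_ge0. Qed.

Lemma Re_gt_Im (c : R[i]) :
  0 <= complex.Re c -> 0 < complex.Re (c ^+ 2) -> `|complex.Im c| < complex.Re c.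
Proof.
case: c => a b a0; rewrite expr2 /= -!expr2 subr_gt0 => h.
by rewrite -ltr_sqr ?nnegrE // real_normK // num_real.
Qed.

Lemma ReM_gt_Im (c d : R[i]) : `|complex.Im c| < complex.Re c ->
  `|complex.Im d| < complex.Re d -> 0 < complex.Re (c * d).
Proof.
case: c => a b; case: d => a' b' /= h h'; rewrite subr_gt0.
apply: le_lt_trans (ler_norm _) _; rewrite normrM.
by apply: ltr_pM.
Qed.

Lemma Re_ge0_near1 (c : R[i]) : `|c - 1| <= 1 -> 0 <= complex.Re c.
Proof.
move=> h; have := le_trans (normc_ge_Re (c - 1)) h.
by rewrite -[1 in leRHS]/(1%:C)%C lecR; case: c {h} => a b /=; rewrite ler_norml => /andP[]; lra.
Qed.

Lemma Re_cayley_gt0 (u : R[i]) : `|u| < 1 -> 0 < complex.Re ((1 + u) / (1 - u)).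
Proof.
case: u => a b; rewrite normc_def -[1 in ltRHS]/(1%:C)%C ltcR /=.
rewrite -[ltRHS]sqrtr1 ltr_sqrt ?ltr01 // => h.
have n0 : 0 < (1 - a) ^+ 2 + b ^+ 2 by nra.
rewrite !add0r mulNr opprK sqrrN.
have -> : (1 + a) * ((1 - a) / ((1 - a) ^+ 2 + b ^+ 2))
   - b * (b / ((1 - a) ^+ 2 + b ^+ 2)) =
   (1 - (a ^+ 2 + b ^+ 2)) / ((1 - a) ^+ 2 + b ^+ 2).
  by field; rewrite gt_eqF.
by rewrite divr_gt0 // subr_gt0.
Qed.

(* [1 - u] and [1 + u] lie in the right half-plane, so their principal roots
   lie in the sector |arg| < pi/4. *)
Lemma Re_scaled_sqrtc_gt0 (u : R[i]) : `|u| < 1 ->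
  0 < complex.Re ((1 - u) * sqrtc ((1 + u) / (1 - u))).
Proof.
move=> u1; set s := sqrtc _; set a := sqrtc (1 - u).
have ur : `|complex.Re u| < 1.
  by have := le_lt_trans (normc_ge_Re u) u1; rewrite -[1 in ltRHS]/(1%:C)%C ltcR.
have /andP[u_gt u_lt] : -1 < complex.Re u < 1 by rewrite -ltr_norml.
have p0 : 0 < complex.Re (1 - u) by case: u {s a u1 ur} u_gt u_lt => x y /=; lra.
have q0 : 0 < complex.Re (1 + u) by case: u {s a u1 ur p0} u_gt u_lt => x y /=; lra.
have pn0 : 1 - u != 0 by apply: contraTneq p0 => ->; rewrite ltxx.
have aE : a ^+ 2 = 1 - u by exact: sqr_sqrtc.
have sE : s ^+ 2 = (1 + u) / (1 - u) by exact: sqr_sqrtc.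
have ha : `|complex.Im a| < complex.Re a.
  by apply: Re_gt_Im; rewrite ?aE ?Re_sqrtc_ge0.
have hs : `|complex.Im s| < complex.Re s.
  apply: Re_gt_Im; rewrite ?Re_sqrtc_ge0 // sE.
  exact: Re_cayley_gt0.
(* Write [(1 - u) * s] as [a * (a * s)]. The product [a * s] has positive real part and square
   [1 + u], so it lies in the sector as well. *)
rewrite -aE expr2 -mulrA; apply: ReM_gt_Im => //.
apply: Re_gt_Im; first exact/ltW/ReM_gt_Im.
by rewrite exprMn aE sE mulrC divfK.
Qed.

(** With [f] a partial sum, the square estimate bounds [(f - s) * ((1 - u) * (f + s))]. The second
    factor has real part at least [sigma > 0], so dividing by it leaves a geometric bound on
    [f - s]. *)
Lemma cvg_sqrt_psum (u : R[i]) : `|u| < 1 ->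
  sqrt_psum u @ \oo --> (sqrtc ((1 + u) / (1 - u)) : R[i]^o).
Proof.
move=> u1; have := Re_scaled_sqrtc_gt0 u u1; set s := sqrtc _ => sig0.
have sE : s ^+ 2 = (1 + u) / (1 - u) by exact: sqr_sqrtc.
have pn0 : 1 - u != 0 by apply: contraTneq sig0 => ->; rewrite mul0r ltxx.
have r0 : 0 < 1 - `|u| by rewrite subr_gt0.
set sigma := complex.Re _ in sig0.
have sigC : 0 < sigma%:C%C :> R[i] by rewrite ltcR.
pose M := 6 / ((1 - `|u|) * sigma%:C%C).
have M0 : 0 <= M by rewrite divr_ge0 ?ler0n // ltW // mulr_gt0.
have bound N : `|s - sqrt_psum u N.+1| <= M * `|u| ^+ N.+1.
  have := sqrt_psum_sqr _ u N u1; set f := sqrt_psum u N.+1 => h.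
  rewrite /M mulrAC ler_pdivlMr ?mulr_gt0 //; apply: le_trans h.
  rewrite mulrCA ler_wpM2l ?(ltW r0) //.
  have -> : (1 - u) * f ^+ 2 - (1 + u) = (f - s) * ((1 - u) * (f + s)).
    rewrite [in LHS](_ : 1 + u = (1 - u) * s ^+ 2); first by ring.
    by rewrite sE mulrC divfK.
  rewrite normrM distrC ler_wpM2l // mulrDr.
  apply: le_trans (normc_ge_Re _); rewrite lecR raddfD /=.
  have := Re_ge0_near1 _ (sqrt_psum_near1 _ u N.+1 (ltW u1)); rewrite -/f => fge0.
  rewrite -/sigma ger0_norm ?lerDr // addr_ge0 // ltW //.
apply/(@cvgrPdist_lt _ R[i]^o) => eps eps0.
have [N _ DN] := geometric_lt_near _ _ _ (normr_ge0 u) u1 M0 eps0.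
exists N.+1 => // -[|n] //= Nn.
by apply: le_lt_trans (bound n) _; apply: DN; rewrite /= ltnW.
Qed.

(** * Convergence of the two generating functions *)

Lemma serG_rec (x z : R[i]) n : serG x z n.+1 = z * (1 + x ^+ 2) * serG x z n
  + (1 + (1 - x) / 2 * (sqrt_psum (2 * (x * z)) n.+1 - 1)).
Proof.
rewrite /serG /series /= !big_mkord big_ord_recl /sqrt_psum big_ord_recl /=.
rewrite sqrt_coef0 !expr0 !mulr1 addrC [1 + \sum_(i < n) _]addrC addrK.
rewrite mulr_sumr mulr_sumr addrC addrCA; congr (_ + _).
  by rewrite horner_Ppoly big_ord1 bin0 expr0 mulr1.
rewrite -big_split; apply: eq_bigr => i _ /=.
(* The power [2 ^+ i] in [sqrt_coefSE] rescales [x * z] to [2 * (x * z)]; the odd factor 2 left over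
   is the one in [(1 - x) / 2]. *)
rewrite horner_Ppoly_rec sqrt_coefSE /bump /= add1n !exprMn !exprS.
have t2 : (2 ^+ i : R[i]) != 0 by rewrite expf_neq0 ?pnatr_eq0.
by field.
Qed.

Lemma cvg_serG (x z : R[i]) : `|z * (1 + x ^+ 2)| < 1 -> `|x * z| < 1 / 2 ->
  serG x z @ \oo --> (closedG x z : R[i]^o).
Proof.
move=> D1 w1.
have u1 : `|2 * (x * z)| < 1.
  by rewrite normrM (ger0_norm (ler0n _ 2)) mulrC -ltr_pdivlMr ?ltr0n.
set s := sqrtc ((1 + 2 * (x * z)) / (1 - 2 * (x * z))).
have -> : closedG x z = (1 + (1 - x) / 2 * (s - 1)) / (1 - z * (1 + x ^+ 2)).
  rewrite /closedG -!(mulrA 2) -/s.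
  have nD : 1 - z * (1 + x ^+ 2) != 0.
    by apply: contraTneq D1 => /eqP; rewrite subr_eq0 => /eqP <-; rewrite normr1 ltxx.
  by field.
apply: (cvg_linear_rec _ _ _ _ D1 (serG_rec x z)).
have h : sqrt_psum (2 * (x * z)) n.+1 @[n --> \oo] --> (s : R[i]^o).
  rewrite (cvg_shiftS (sqrt_psum _)); exact: cvg_sqrt_psum.
apply: (@cvgD _ R[i]^o); first exact: cvg_cst.
apply: (@cvgZl_tmp _ R[i]^o _ _ _ ((1 - x) / 2)).
exact: (@cvgB _ R[i]^o _ _ _ _ _ _ _ h (cvg_cst _)).
Qed.

Lemma horner_Rpoly (x : R[i]) n : x != 0 ->
  (Rpoly R[i] n).[x] = x ^+ n * (Ppoly R[i] n).[x^-1].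
Proof.
move=> x0; rewrite /Rpoly /Ppoly !horner_sum mulr_sumr; apply: eq_bigr => k _.
rewrite !hornerZ !hornerXn exprVn mulrCA; congr (_ * _).
have kn : (k <= n)%N by rewrite -ltnS.
by rewrite -[in X in X / _](subnK kn) exprD mulrAC divff ?mul1r // expf_neq0.
Qed.

(** The substitution [(x, z) -> (1/x, x * z)] turns series, closed form and both conditions into
    those of [cvg_serG]; the strict first bound gives [x != 0]. *)
Lemma cvg_serH (x z : R[i]) : `|z * (1 + x ^+ 2)| < `|x| -> `|2 * z| < 1 ->
  serH x z @ \oo --> (closedH x z : R[i]^o).
Proof.
move=> Dx z1.
have x0 : x != 0 by rewrite -normr_gt0; apply: le_lt_trans Dx.
have E : x * z * (1 + x^-1 ^+ 2) = z * (1 + x ^+ 2) / x by field.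
have -> : serH x z = serG x^-1 (x * z).
  rewrite /serH /serG; congr series; apply/funext => n.
  by rewrite horner_Rpoly // exprMn; ring.
have D1 : `|x * z * (1 + x^-1 ^+ 2)| < 1.
  by rewrite E normrM normfV ltr_pdivrMr ?normr_gt0 // mul1r.
have nD : x - z * (1 + x ^+ 2) != 0.
  by apply: contraTneq Dx => /eqP; rewrite subr_eq0 => /eqP <-; rewrite ltxx.
have -> : closedH x z = closedG x^-1 (x * z).
  have w : 2 * x^-1 * (x * z) = 2 * z by field.
  rewrite /closedH /closedG w E; set s := sqrtc _.
  field.
  by rewrite x0 nD.
apply: cvg_serG => //.
by rewrite mulKf // ltr_pdivlMr ?ltr0n // mulrC -[2 in ltLHS](ger0_norm (ler0n _ 2)) -normrM.
Qed.

End ComplexAnalysis.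

Theorem theorem3p4 (R : realType) :
  (forall x z : R[i], `|z * (1 + x ^+ 2)| < 1 -> `|x * z| < 1 / 2 ->
     serG x z @ \oo --> (closedG x z : R[i]^o)) /\
  (forall x z : R[i], `|z * (1 + x ^+ 2)| < `|x| -> `|2 * z| < 1 ->
     serH x z @ \oo --> (closedH x z : R[i]^o)).
Proof. by split=> x z; [exact: cvg_serG|exact: cvg_serH]. Qed.
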